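(* Let $\Phi\subset\mathbb{R}^3$ be a skew ruled surface of class $C^3$, parametrized by $\boldsymbol{x}(u,v)=\boldsymbol{s}(u)+v\,\boldsymbol{e}(u)$, $(u,v)\in I\times\mathbb{R}$, as in the context, with conical curvature $k(u)$, distribution parameter $\delta(u)$ and $w=\sqrt{v^2+\delta(u)^2}$. Suppose that one of the two principal curvatures $k_1,k_2$ of $\Phi$ has the form $$k_i(u,v)=f(u)\,w^{n}\qquad\text{for all }(u,v)\in I\times\mathbb{R},$$ for $i=1$ or $i=2$, with some $n\in\mathbb{Z}$ and some continuous function $f:I\to\mathbb{R}$. Then one of the following holds: (a) $n=-1$, $f(u)=-k(u)$, and $\Phi$ is an Edlinger surface. (b) $n=-2$, $f(u)=\pm\delta(u)$, and $\Phi$ is a (right) helicoid. (c) $n=-3$, $f(u)=\delta^2(u)\,k^{-1}(u)$, and $\Phi$ is an Edlinger surface.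
   Context: Setting. $I\subset\mathbb{R}$ is an open interval and $\Phi$ is a regular ruled surface in Euclidean space $\mathbb{R}^3$ without torsal generators (''skew''), of class $C^3$ on $I\times\mathbb{R}$, with parametrization $\boldsymbol{x}(u,v)=\boldsymbol{s}(u)+v\,\boldsymbol{e}(u)$, where $\boldsymbol{s}$ is the striction line and $\boldsymbol{e}$ is the unit vector along the generators. Prime denotes $d/du$. It is assumed that $\langle \boldsymbol{s}'(u),\boldsymbol{e}'(u)\rangle=0$ and $|\boldsymbol{e}'(u)|=1$ for all $u\in I$. Moving frame: $\boldsymbol{n}:=\boldsymbol{e}'$, $\boldsymbol{z}:=\boldsymbol{e}\times\boldsymbol{n}$. Invariants (with $(\cdot,\cdot,\cdot)$ the triple product): conical curvature $k=(\boldsymbol{e},\boldsymbol{e}',\boldsymbol{e}'')$; distribution parameter (Drall) $\delta=(\boldsymbol{e},\boldsymbol{e}',\boldsymbol{s}')$, which is nowhere zero since $\Phi$ is skew; striction $\sigma$, the angle between $\boldsymbol{e}$ and $\boldsymbol{s}'$, and $\lambda:=\cot\sigma=\langle\boldsymbol{e},\boldsymbol{s}'\rangle/\delta$. Thus $\boldsymbol{s}'=\delta\lambda\,\boldsymbol{e}+\delta\,\boldsymbol{z}$. With $u^1=u$, $u^2=v$ and $w:=\sqrt{v^2+\delta^2}$, the fundamental forms (unit normal $(\boldsymbol{x}_u\times\boldsymbol{x}_v)/w$) are $g_{11}=v^2+\delta^2(\lambda^2+1)$, $g_{12}=\delta\lambda$, $g_{22}=1$, $h_{11}=-\frac1w\,[k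 v^2+\delta' v+\delta^2(k-\lambda)]$, $h_{12}=\frac{\delta}{w}$, $h_{22}=0$. Principal curvatures are taken with respect to these forms, and their numbering as $k_1,k_2$ is arbitrary. Terminology. $\Phi$ is an Edlinger surface if all its osculating quadrics are hyperboloids of revolution; equivalently, $\delta'=0$ and $k\lambda+1=0$ identically on $I$. $\Phi$ is a (right) helicoid (Wendelfläche) if $k=\lambda=\delta'=0$ identically on $I$. *)

(* Defs.v *)
From HB Require Import structures.
From mathcomp Require Import all_boot all_order all_algebra.
From mathcomp Require Import all_classical all_reals all_analysis.

Set Implicit Arguments.
Unset Strict Implicit.
Unset Printing Implicit Defensive.

Import Order.TTheory GRing.Theory Num.Theory.
Import numFieldNormedType.Exports.

Local Open Scope classical_set_scope.
Local Open Scope ring_scope.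

Section EuclideanSpace.
Variable R : realType.
Implicit Types a b c : 'rV[R]_3.

Definition dot a b : R := \sum_i a 0 i * b 0 i.

(* The library norm `|a| on 'rV[R]_3 is the sup norm, hence this one. *)
Definition enorm a : R := Num.sqrt (dot a a).

(* Indices are added modulo 3. *)
Definition cross a b : 'rV[R]_3 :=
  \row_(i < 3) (a 0 (i + 1) * b 0 (i + 2) - a 0 (i + 2) * b 0 (i + 1)).

Definition triple a b c : R := dot (cross a b) c.

(* One-sheeted, with axis c + R a; a hyperboloid of two sheets carries no
   straight line and cannot be an osculating quadric of a ruled surface. *)
Definition hyperboloid_of_revolution (Q : set 'rV[R]_3) : Prop :=
  exists (c a : 'rV[R]_3) (p q : R),
    [/\ enorm a = 1, 0 < p, 0 < q &
      Q = [set y | (dot (y - c) (y - c) - dot (y - c) a ^+ 2) / p ^+ 2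
                   - dot (y - c) a ^+ 2 / q ^+ 2 = 1]].

End EuclideanSpace.

Section ParametrizedSurfaces.
Variable R : realType.
Implicit Type x : R -> R -> 'rV[R]_3.

Definition slice (i : 'I_2) x (u v : R) : R -> 'rV[R]_3 :=
  if i == 0 then fun t => x t v else fun t => x u t.

Definition coord (i : 'I_2) (u v : R) : R := if i == 0 then u else v.

Definition partial (i : 'I_2) x (u v : R) : 'rV[R]_3 :=
  derive1 (slice i x u v) (coord i u v).

Fixpoint class_C (m : nat) (D : set (R * R)) x : Prop :=
  {within D, continuous (fun p : R * R => x p.1 p.2)} /\
  if m is m'.+1 then
    forall i : 'I_2,
      (forall u v : R, D (u, v) ->
         derivable (slice i x u v) (coord i u v) 1) /\
      class_C m' D (partial i x)
  else True.

Definition regular_on (D : set (R * R)) x : Prop :=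
  forall u v : R, D (u, v) -> cross (partial 0 x u v) (partial 1 x u v) != 0.

Definition unit_normal x (u v : R) : 'rV[R]_3 :=
  let N := cross (partial 0 x u v) (partial 1 x u v) in (enorm N)^-1 *: N.

Definition first_form x (u v : R) : 'M[R]_2 :=
  \matrix_(i < 2, j < 2) dot (partial i x u v) (partial j x u v).

Definition second_form x (u v : R) : 'M[R]_2 :=
  \matrix_(i < 2, j < 2) dot (partial j (partial i x) u v) (unit_normal x u v).

Definition weingarten x (u v : R) : 'M[R]_2 :=
  invmx (first_form x u v) *m second_form x u v.

(* k1 and k2 are the eigenvalues, with multiplicity, in an arbitrary order. *)
Definition principal_curvatures_at x (u v k1 k2 : R) : Prop :=
  char_poly (weingarten x u v) = ('X - k1%:P) * ('X - k2%:P).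

Definition tangent_vector x (u v : R) (a : 'rV[R]_2) : 'rV[R]_3 :=
  a 0 0 *: partial 0 x u v + a 0 1 *: partial 1 x u v.

Definition asymptotic x (u v : R) (a : 'rV[R]_2) : Prop :=
  (a *m second_form x u v *m a^T) 0 0 = 0.

End ParametrizedSurfaces.

Section RuledSurfaces.
Variable R : realType.
Variables s e : R -> 'rV[R]_3.

Definition ruled (u v : R) : 'rV[R]_3 := s u + v *: e u.

Definition conical_curvature (u : R) : R :=
  triple (e u) (derive1 e u) (derive1n 2 e u).

Definition drall (u : R) : R := triple (e u) (derive1 e u) (derive1 s u).

(* The cotangent of the striction, i.e. of the angle between e and s'. *)
Definition cot_striction (u : R) : R := dot (e u) (derive1 s u) / drall u.

Definition wfun (u v : R) : R := Num.sqrt (v ^+ 2 + drall u ^+ 2).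

(* Parametrization by a striction line and by the arc length of the spherical
   image of the generators; nonvanishing of the distribution parameter means
   that there is no torsal generator. *)
Definition skew_ruled_surface (I : set R) : Prop :=
  [/\ class_C 3 (I `*` setT) ruled,
      regular_on (I `*` setT) ruled,
      forall u, I u -> drall u != 0 &
      forall u, I u ->
        [/\ enorm (e u) = 1, enorm (derive1 e u) = 1 &
            dot (derive1 s u) (derive1 e u) = 0]].

(* The osculating quadric along the generator u is swept out by the asymptotic
   tangents at the points of that generator. They contain infinitely many
   pairwise skew lines, so at most one quadric contains them all. *)
Definition osculating_quadric (u : R) (Q : set 'rV[R]_3) : Prop :=
  forall (v t : R) (a : 'rV[R]_2), asymptotic ruled u v a ->
    Q (ruled u v + t *: tangent_vector ruled u v a).

(* For a skew ruled surface, the first clause for all u is equivalent to the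
   other two for all u; both descriptions are recorded. *)
Definition edlinger (I : set R) : Prop :=
  forall u, I u ->
    [/\ exists Q, hyperboloid_of_revolution Q /\ osculating_quadric u Q,
        derive1 drall u = 0 &
        conical_curvature u * cot_striction u + 1 = 0].

Definition right_helicoid (I : set R) : Prop :=
  forall u, I u ->
    [/\ conical_curvature u = 0, cot_striction u = 0 & derive1 drall u = 0].

End RuledSurfaces.

(* Main.v *)
Require Import Defs.
From mathcomp Require Import all_boot all_order all_algebra.
From mathcomp Require Import all_classical all_reals all_analysis.
From mathcomp Require Import ring lra.
Import Order.TTheory GRing.Theory Num.Theory.
Import numFieldNormedType.Exports.
Local Open Scope classical_set_scope.
Local Open Scope ring_scope.

(** In the moving frame (e, n, z), with n = e' and z = e x n, the derivatives of
    the two curves are s' = delta lambda e + delta z and e'' = - e + k z, and the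
    components of s'' along n and z are delta (lambda - k) and delta'. The two
    fundamental forms follow, and a principal curvature c, being a solution of
    det (c g - h) = 0, satisfies ([principal_curvature_eq])

      c^2 w^4 + c w (k w^2 + delta' v + delta^2 lambda) = delta^2.

    Let c = f w^n. The function w is even in v, so comparing v = 1 and v = -1
    gives delta' = 0. For a fixed u, as v varies, w takes all values
    x >= |delta|, and the equation becomes

      f^2 x^(2n+4) + f k x^(n+3) + f delta^2 lambda x^(n+1) = delta^2.

    Here f cannot vanish since delta does not. For n >= 0 and for n <= -4 the
    exponent 0 (resp. 2n+4) occurs once and is the least one, so its nonzero
    coefficient contradicts the linear independence of the powers of x. For
    n = -1, -2, -3 some of the exponents coincide, and comparison of coefficients gives
    the three cases ([power_curvature_cases]): k lambda = -1 with f = - k or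
    f = delta^2 / k, and f^2 = delta^2 with k = lambda = 0. In the last one the
    sign in f = +- delta is the same on all of I because I is connected and f
    and delta are continuous ([continuous_sqr_eq]).

    The Edlinger condition also asks for a hyperboloid of revolution that
    osculates along the generator. In coordinates (X, Y, Z) with respect to the
    frame at s(u), the asymptotic tangents along the generator sweep out
    k Y^2 + (k + lambda) Z^2 - 2 X Z + 2 delta Y = 0 when delta' = 0. With
    lambda = -1/k the form k Y^2 + (k + lambda) Z^2 - 2 X Z has eigenvalues k,
    k and -1/k, which makes the quadric a hyperboloid of revolution around a
    line parallel to k e + z ([osculating_hyperboloid]). *)

(** * The Euclidean space of dimension three *)

Section VectorAlgebra.
Context {R : realType}.
Implicit Types (a b c x y z : 'rV[R]_3) (p q r : R).

Lemma sum3E (F : 'I_3 -> R) : \sum_i F i = F 0 + F 1 + F 2%:R.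
Proof.
rewrite !big_ord_recr big_ord0 /= add0r.
by congr (F _ + F _ + F _); apply: val_inj.
Qed.

Lemma dotE a b : dot a b = a 0 0 * b 0 0 + a 0 1 * b 0 1 + a 0 2 * b 0 2.
Proof. exact: sum3E. Qed.

(** The definition of [cross] adds indices modulo 3; this brings them back to
    numerals. *)
Lemma ord3_addE : (0 + 1 = 1 :> 'I_3) * (0 + 2 = 2 :> 'I_3) * (1 + 1 = 2 :> 'I_3) *
  (1 + 2 = 0 :> 'I_3) * (2 + 1 = 0 :> 'I_3) * (2 + 2 = 1 :> 'I_3).
Proof. by do ![split]; apply: val_inj. Qed.

Lemma row3P a b : a 0 0 = b 0 0 -> a 0 1 = b 0 1 -> a 0 2 = b 0 2 -> a = b.
Proof.
move=> e0 e1 e2; apply/rowP => -[[|[|[|//]]] i3].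
- by rewrite (_ : Ordinal i3 = 0) //; apply: val_inj.
- by rewrite (_ : Ordinal i3 = 1) //; apply: val_inj.
- by rewrite (_ : Ordinal i3 = 2) //; apply: val_inj.
Qed.

Lemma dotC a b : dot a b = dot b a.
Proof. by rewrite !dotE; ring. Qed.

Lemma dotDl a b c : dot (a + b) c = dot a c + dot b c.
Proof. by rewrite !dotE !mxE; ring. Qed.

Lemma dotZl p a c : dot (p *: a) c = p * dot a c.
Proof. by rewrite !dotE !mxE; ring. Qed.

Lemma dotDr a b c : dot c (a + b) = dot c a + dot c b.
Proof. by rewrite !dotE !mxE; ring. Qed.

Lemma dotZr p a c : dot c (p *: a) = p * dot c a.
Proof. by rewrite !dotE !mxE; ring. Qed.

Lemma dotNl a c : dot (- a) c = - dot a c.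
Proof. by rewrite -scaleN1r dotZl mulN1r. Qed.

Lemma crossDl a b c : cross (a + b) c = cross a c + cross b c.
Proof. by apply: row3P; rewrite !mxE !ord3_addE; ring. Qed.

Lemma crossZl p a c : cross (p *: a) c = p *: cross a c.
Proof. by apply: row3P; rewrite !mxE !ord3_addE; ring. Qed.

Lemma cross_self a : cross a a = 0.
Proof. by apply: row3P; rewrite !mxE !ord3_addE; ring. Qed.

Lemma crossC a b : cross a b = - cross b a.
Proof. by apply: row3P; rewrite !mxE !ord3_addE; ring. Qed.

Lemma crossDr a b c : cross c (a + b) = cross c a + cross c b.
Proof. by rewrite crossC crossDl opprD -!(crossC c). Qed.

Lemma crossZr p a c : cross c (p *: a) = p *: cross c a.
Proof. by rewrite crossC crossZl -scalerN -crossC. Qed.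

Lemma double_cross a b c : cross a (cross b c) = dot a c *: b - dot a b *: c.
Proof.
by apply: row3P; rewrite !mxE !ord3_addE !dotE; ring.
Qed.

Lemma dot_enorm1 (a : 'rV[R]_3) : enorm a = 1 -> dot a a = 1.
Proof.
move=> a1; rewrite -[dot a a]sqr_sqrtr -/(enorm a) ?a1 ?expr1n //.
by apply: sumr_ge0 => i _; rewrite -expr2 sqr_ge0.
Qed.

(** The vectors b x c, c x a, a x b form, up to the factor (a, b, c), the basis
    dual to a, b, c when that factor is nonzero. *)
Lemma triple_reciprocal a b c y :
  triple a b c *: y =
    dot a y *: cross b c + dot b y *: cross c a + dot c y *: cross a b.
Proof. by apply: row3P; rewrite /triple !dotE !mxE !ord3_addE; ring. Qed.

Section OrthonormalPair.
Variables a b : 'rV[R]_3.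
Hypotheses (aa : dot a a = 1) (bb : dot b b = 1) (ab : dot a b = 0).

Lemma cross_bc : cross b (cross a b) = a.
Proof. by rewrite double_cross bb dotC ab scale1r scale0r subr0. Qed.

Lemma cross_ca : cross (cross a b) a = b.
Proof. by rewrite crossC double_cross aa ab scale1r scale0r sub0r opprK. Qed.

Lemma dot_ac : dot a (cross a b) = 0.
Proof. by rewrite !dotE !mxE !ord3_addE; ring. Qed.

Lemma dot_bc : dot b (cross a b) = 0.
Proof. by rewrite !dotE !mxE !ord3_addE; ring. Qed.

(** Lagrange's identity, |a x b|^2 = |a|^2 |b|^2 - <a, b>^2. *)
Lemma dot_cc : dot (cross a b) (cross a b) = 1.
Proof.
transitivity (dot a a * dot b b - dot a b ^+ 2); last by rewrite aa bb ab; ring.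
by rewrite !dotE !mxE !ord3_addE; ring.
Qed.

Lemma frame_expansion y :
  y = dot a y *: a + dot b y *: b + triple a b y *: cross a b.
Proof.
have := triple_reciprocal a b (cross a b) y.
by rewrite /triple dot_cc scale1r cross_bc cross_ca.
Qed.

Lemma dot_frame p q r p' q' r' :
  dot (p *: a + q *: b + r *: cross a b) (p' *: a + q' *: b + r' *: cross a b)
  = p * p' + q * q' + r * r'.
Proof.
rewrite !(dotDl, dotDr, dotZl, dotZr) aa bb dot_cc ab dot_ac dot_bc.
by rewrite (dotC b a) ab !(dotC (cross a b)) dot_ac dot_bc; ring.
Qed.

Lemma cross_frame p q r :
  cross (p *: a + q *: b + r *: cross a b) a = r *: b - q *: cross a b.
Proof.
rewrite !(crossDl, crossZl) cross_self cross_ca (crossC b a).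
by rewrite scaler0 add0r addrC scalerN.
Qed.

End OrthonormalPair.
End VectorAlgebra.

(** * Derivatives of curves *)

Section Calculus.
Context {R : realType}.
Implicit Types (a b : R -> 'rV[R]_3) (t : R).

Lemma is_derive_entry a t i : derivable a t 1 ->
  is_derive t 1 (fun x => a x 0 i) (derive1 a t 0 i).
Proof.
move=> da; have dai : derivable (fun x => a x 0 i) t 1.
  exact: ((derivable_mxP a t 1).1 da 0 i).
apply: DeriveDef => //; by rewrite derive1E derive_mx // mxE.
Qed.

Lemma is_derive_dot a b t : derivable a t 1 -> derivable b t 1 ->
  is_derive t 1 (fun x => dot (a x) (b x))
    (dot (derive1 a t) (b t) + dot (a t) (derive1 b t)).
Proof.
move=> da db.
rewrite (_ : (fun x => _) =
  \sum_(i < 3) ((fun x => a x 0 i) * (fun x => b x 0 i))); last first.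
  by apply/funext => x; rewrite fct_sumE.
have Da i := is_derive_entry a t i da.
have Db i := is_derive_entry b t i db.
apply: is_derive_eq.
rewrite /dot -big_split; apply: eq_bigr => i _ /=.
by rewrite /GRing.scale /=; ring.
Qed.

Lemma is_derive_cross a b t : derivable a t 1 -> derivable b t 1 ->
  is_derive t 1 (fun x => cross (a x) (b x))
    (cross (derive1 a t) (b t) + cross (a t) (derive1 b t)).
Proof.
move=> da db.
have Da i := is_derive_entry a t i da.
have Db i := is_derive_entry b t i db.
have Dc (i : 'I_3) : is_derive t 1 (fun x => cross (a x) (b x) 0 i)
    ((cross (derive1 a t) (b t) + cross (a t) (derive1 b t)) 0 i).
  rewrite (_ : (fun x => _) = (fun x => a x 0 (i + 1)) * (fun x => b x 0 (i + 2))
     - (fun x => a x 0 (i + 2)) * (fun x => b x 0 (i + 1))); last first.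
    by apply/funext => x; rewrite mxE.
  by apply: is_derive_eq; rewrite !mxE /GRing.scale /=; ring.
have dc : derivable (fun x => cross (a x) (b x)) t 1.
  by apply/derivable_mxP => i j; rewrite (ord1 i); have [] := Dc j.
apply: DeriveDef => //; rewrite derive_mx //; apply/rowP => j.
by rewrite mxE; have [_ ->] := Dc j.
Qed.

(** The class of a ruled surface is a property of its parametrization. The values
    v = 0 and v = 1 transfer it to the directrix and to the generators, and,
    applied to the first derivatives, to s' and e'. *)
Lemma derivable_pencil (a b : R -> 'rV[R]_3) u :
  (forall v, derivable (fun t => a t + v *: b t) u 1) ->
  derivable a u 1 /\ derivable b u 1.
Proof.
move=> dab; have da : derivable a u 1.
  have -> : a = fun t => a t + 0 *: b t.
    by apply/funext => t; rewrite scale0r addr0.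
  exact: dab.
split; first exact: da.
have -> : b = (fun t => a t + 1 *: b t) - a.
  by apply/funext => t; rewrite !fctE scale1r addrC addKr.
by apply: derivableB; [exact: dab | exact: da].
Qed.

Lemma derive1_pencil (a b : R -> 'rV[R]_3) u v :
  derivable a u 1 -> derivable b u 1 ->
  derive1 (fun t => a t + v *: b t) u = derive1 a u + v *: derive1 b u.
Proof.
move=> da db; rewrite !derive1E.
have dab : is_derive u 1 (a + v \*: b) ('D_1 a u + v *: 'D_1 b u).
  exact: (is_deriveD (derivableP da) (is_deriveZ v (derivableP db))).
by have [_ ->] := dab.
Qed.

Lemma derive1_affine (a b : 'rV[R]_3) v : derive1 (fun t => a + t *: b) v = b.
Proof.
have dab (i : 'I_1) (j : 'I_3) :
    is_derive v 1 (fun t => (a + t *: b) i j) (b i j).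
  rewrite (_ : (fun t => _) = cst (a i j) + b i j \*: id); last first.
    by apply/funext => t; rewrite !mxE /= !fctE mulrC.
  have := is_deriveD (is_derive_cst (a i j) v 1)
    (is_deriveZ (b i j) (is_derive_id v 1)).
  by rewrite add0r /GRing.scale /= mulr1.
have d : derivable (fun t : R => a + t *: b) v 1.
  by apply/derivable_mxP => i j; have [] := dab i j.
by rewrite derive1E derive_mx //; apply/matrixP => i j; rewrite mxE; have [] := dab i j.
Qed.

End Calculus.

(** * Fundamental forms and principal curvatures *)

Section TwoByTwo.
Context {R : realType}.

Lemma det2E (A : 'M[R]_2) : \det A = A 0 0 * A 1 1 - A 0 1 * A 1 0.
Proof.
rewrite (expand_det_row _ 0) !big_ord_recr big_ord0 /= add0r /cofactor.
rewrite !det_mx11 !mxE /= expr0 expr1 mul1r mulN1r mulrN.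
by congr (A _ _ * A _ _ - A _ _ * A _ _); apply: val_inj.
Qed.

Lemma quadratic_form2E (A : 'M[R]_2) (a : 'rV[R]_2) :
  (a *m A *m a^T) 0 0 = a 0 0 ^+ 2 * A 0 0 + a 0 0 * a 0 1 * (A 0 1 + A 1 0)
    + a 0 1 ^+ 2 * A 1 1.
Proof.
have sum2E (F : 'I_2 -> R) : \sum_i F i = F 0 + F 1.
  by rewrite !big_ord_recr big_ord0 /= add0r; congr (F _ + F _); apply: val_inj.
by rewrite mxE sum2E !mxE !sum2E; ring.
Qed.

(** If y is a left eigenvector of g^-1 h for c, then y g^-1 is a left null
    vector of c g - h. *)
Lemma principal_curvature_det x u v (k1 k2 c : R) :
  first_form x u v \in unitmx ->
  principal_curvatures_at x u v k1 k2 -> c = k1 \/ c = k2 ->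
  \det (c *: first_form x u v - second_form x u v) = 0.
Proof.
move=> Ug k12 ck.
have : root (char_poly (weingarten x u v)) c.
  by rewrite k12 rootM !root_XsubC; case: ck => ->; rewrite eqxx ?orbT.
rewrite -eigenvalue_root_char => /eigenvalueP[y yW y0].
apply/eqP/det0P; exists (y *m invmx (first_form x u v)).
  by apply: contra_neq y0 => yg0; rewrite -(mulmxKV Ug y) yg0 mul0mx.
rewrite mulmxBr -scalemxAr mulmxKV // -mulmxA.
by move: yW; rewrite /weingarten => ->; rewrite subrr.
Qed.

End TwoByTwo.

(** * The moving frame of a skew ruled surface *)

Section SkewRuled.
Context {R : realType} (I : set R) (s e : R -> 'rV[R]_3).
Hypotheses (I_open : open I) (skew : skew_ruled_surface s e I).
Implicit Types u v : R.

Local Notation k := (conical_curvature e).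
Local Notation delta := (drall s e).
Local Notation lambda := (cot_striction s e).
Local Notation e' := (derive1 e).
Local Notation s' := (derive1 s).
Local Notation z u := (cross (e u) (e' u)).
Local Notation w := (wfun s e).

Lemma near_I u : I u -> \forall t \near u, I t.
Proof. by move=> Iu; apply: open_nbhs_nbhs. Qed.

Lemma derivable_s_e u : I u -> derivable s u 1 /\ derivable e u 1.
Proof.
move=> Iu; apply: derivable_pencil => v.
by have [[_ /(_ 0)[+ _]] _ _ _] := skew; apply.
Qed.

Lemma partial0E u v : I u -> partial 0 (ruled s e) u v = s' u + v *: e' u.
Proof. by move=> /derivable_s_e[ds de]; exact: derive1_pencil. Qed.

Lemma partial1E u v : partial 1 (ruled s e) u v = e u.
Proof. exact: derive1_affine. Qed.

Lemma partial0_near u v : I u ->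
  \forall t \near u, partial 0 (ruled s e) t v = s' t + v *: e' t.
Proof. by move=> Iu; near=> t; apply: partial0E; near: t; apply: near_I.
Unshelve. all: by end_near. Qed.

Lemma derivable_s'_e' u : I u -> derivable s' u 1 /\ derivable e' u 1.
Proof.
move=> Iu; apply: derivable_pencil => v.
apply: (near_eq_derivable (partial0_near u v Iu)).
have [[_ /(_ 0)[_ [_ /(_ 0)[+ _]]]] _ _ _] := skew; exact.
Qed.

Lemma partial00E u v : I u ->
  partial 0 (partial 0 (ruled s e)) u v = derive1 s' u + v *: derive1 e' u.
Proof.
move=> Iu; have [ds de] := derivable_s'_e' u Iu.
transitivity (derive1 (fun t => partial 0 (ruled s e) t v) u); first by [].
rewrite -(derive1_pencil _ _ u v ds de) !derive1E.
exact: (near_eq_derive _ (partial0_near u v Iu)).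
Qed.

Lemma partial10E u v : I u -> partial 1 (partial 0 (ruled s e)) u v = e' u.
Proof.
move=> Iu; rewrite /partial /slice /coord /= -[RHS](derive1_affine (s' u) _ v).
by congr (derive1 _ v); apply/funext => t; apply: partial0E.
Qed.

Lemma partial01E u v : partial 0 (partial 1 (ruled s e)) u v = e' u.
Proof.
rewrite /partial /slice /coord /=.
by congr (derive1 _ u); apply/funext => t; apply: partial1E.
Qed.

Lemma partial11E u v : partial 1 (partial 1 (ruled s e)) u v = 0.
Proof.
rewrite -(@derive1_cst R _ (e u) v).
by congr (derive1 _ v); apply/funext => t; apply: partial1E.
Qed.

Lemma dot_ee u : I u -> dot (e u) (e u) = 1.
Proof. by case: skew => _ _ _ /[apply] -[/dot_enorm1]. Qed.

Lemma dot_nn u : I u -> dot (e' u) (e' u) = 1.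
Proof. by case: skew => _ _ _ /[apply] -[_ /dot_enorm1]. Qed.

Lemma dot_s'n u : I u -> dot (s' u) (e' u) = 0.
Proof. by case: skew => _ _ _ /[apply] -[]. Qed.

Lemma delta_neq0 u : I u -> delta u != 0.
Proof. by case: skew => _ _ + _; exact. Qed.

Lemma derive_dot_const (a b : R -> 'rV[R]_3) (c : R) u : I u ->
  derivable a u 1 -> derivable b u 1 ->
  (forall t, I t -> dot (a t) (b t) = c) ->
  dot (derive1 a u) (b u) + dot (a u) (derive1 b u) = 0.
Proof.
move=> Iu da db abc.
have [_ <-] := is_derive_dot a b u da db.
rewrite -[RHS](@derive_cst R _ _ c u 1); apply: near_eq_derive.
by near=> t; apply: abc; near: t; apply: near_I.
Unshelve. all: by end_near. Qed.

Lemma dot_en u : I u -> dot (e u) (e' u) = 0.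
Proof.
move=> Iu; have [_ de] := derivable_s_e u Iu.
have := derive_dot_const e e 1 u Iu de de dot_ee.
by rewrite (dotC (e' u)) => ?; lra.
Qed.

Lemma e''_frame u : I u -> derive1 e' u = - e u + k u *: z u.
Proof.
move=> Iu; have [_ de] := derivable_s_e u Iu.
have [_ de'] := derivable_s'_e' u Iu.
rewrite [LHS](frame_expansion (e u) (e' u) (dot_ee u Iu) (dot_nn u Iu) (dot_en u Iu)).
have := derive_dot_const e e' 0 u Iu de de' dot_en.
have := derive_dot_const e' e' 1 u Iu de' de' dot_nn.
rewrite dot_nn // (dotC (derive1 e' u)) => h1 h2.
have -> : dot (e u) (derive1 e' u) = -1 by lra.
have -> : dot (e' u) (derive1 e' u) = 0 by lra.
by rewrite scaleN1r scale0r addr0.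
Qed.

Lemma s'_frame u : I u -> s' u = (delta u * lambda u) *: e u + delta u *: z u.
Proof.
move=> Iu.
rewrite [LHS](frame_expansion (e u) (e' u) (dot_ee u Iu) (dot_nn u Iu) (dot_en u Iu)).
rewrite (dotC (e' u)) dot_s'n // scale0r addr0 /cot_striction mulrC divfK //.
exact: delta_neq0.
Qed.

(** In (e x e', s')' the term with (e x e')' vanishes: that derivative is
    e x e'' = - k e', which is orthogonal to s'. *)
Lemma derive_delta u : I u -> derive1 delta u = dot (z u) (derive1 s' u).
Proof.
move=> Iu; have [_ de] := derivable_s_e u Iu.
have [ds' de'] := derivable_s'_e' u Iu.
have dz := is_derive_cross e e' u de de'.
have [dz' zE] := dz.
have := is_derive_dot _ s' u dz' ds'; rewrite !derive1E zE => -[_ ->].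
rewrite cross_self add0r -derive1E e''_frame // crossDr crossZr.
rewrite -scaleN1r crossZr cross_self scaler0 add0r double_cross.
rewrite dot_en // dot_ee // scale0r sub0r scale1r dotZl dotNl.
by rewrite (dotC (e' u)) dot_s'n // oppr0 mulr0 add0r -derive1E.
Qed.

Lemma delta_derivable u : I u -> derivable delta u 1.
Proof.
move=> Iu; have [_ de] := derivable_s_e u Iu.
have [ds' de'] := derivable_s'_e' u Iu.
have [dz _] := is_derive_cross e e' u de de'.
by have [] := is_derive_dot _ s' u dz ds'.
Qed.

(** From <s', e'> = 0, by differentiation. *)
Lemma dot_n_s'' u : I u -> dot (e' u) (derive1 s' u) = delta u * (lambda u - k u).
Proof.
move=> Iu; have [ds' de'] := derivable_s'_e' u Iu.
have := derive_dot_const s' e' 0 u Iu ds' de' dot_s'n.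
rewrite e''_frame // dotC [in dot (s' u) _]s'_frame //.
move=> /eqP; rewrite addr_eq0 => /eqP ->.
have := dot_frame (e u) (e' u) (dot_ee u Iu) (dot_nn u Iu) (dot_en u Iu)
  (delta u * lambda u) 0 (delta u) (-1) 0 (k u).
by rewrite !scale0r !addr0 scaleN1r => ->; ring.
Qed.

(** * The curvature equation *)

Lemma dot_moving_frame u p q r p' q' r' : I u ->
  dot (p *: e u + q *: e' u + r *: z u) (p' *: e u + q' *: e' u + r' *: z u)
  = p * p' + q * q' + r * r'.
Proof.
by move=> Iu; apply: dot_frame; [exact: dot_ee|exact: dot_nn|exact: dot_en].
Qed.

Lemma partial0_frame u v : I u -> partial 0 (ruled s e) u v =
  (delta u * lambda u) *: e u + v *: e' u + delta u *: z u.
Proof. by move=> Iu; rewrite partial0E // s'_frame // addrAC. Qed.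

(** The zero coefficients give these vectors the shape that [dot_moving_frame]
    expects. *)
Lemma partial1_frame u v : partial 1 (ruled s e) u v =
  1 *: e u + 0 *: e' u + 0 *: z u.
Proof. by rewrite partial1E !scale0r !addr0 scale1r. Qed.

Lemma partial10_frame u v : I u -> partial 1 (partial 0 (ruled s e)) u v =
  0 *: e u + 1 *: e' u + 0 *: z u.
Proof. by move=> Iu; rewrite partial10E // !scale0r addr0 add0r scale1r. Qed.

(** The component along e is left unevaluated: the unit normal has none, so it
    does not enter the second fundamental form. *)
Lemma partial00_frame u v : I u -> partial 0 (partial 0 (ruled s e)) u v =
  (dot (e u) (derive1 s' u) - v) *: e u
  + (delta u * (lambda u - k u)) *: e' u + (derive1 delta u + v * k u) *: z u.
Proof.
move=> Iu; rewrite partial00E // e''_frame // scalerDr scalerN scalerA.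
have := frame_expansion (e u) (e' u) (dot_ee u Iu) (dot_nn u Iu) (dot_en u Iu)
  (derive1 s' u).
rewrite dot_n_s'' // /triple -derive_delta // => {1}->.
move: (e u) (e' u) (z u) (dot (e u) _) (derive1 delta u) => a b c p d'.
by apply/rowP => i; rewrite !mxE; ring.
Qed.

Lemma w_gt0 u v : I u -> 0 < w u v.
Proof.
move=> Iu; rewrite sqrtr_gt0 ltr_wpDl ?sqr_ge0 //.
by rewrite exprn_even_gt0 // delta_neq0.
Qed.

Lemma sqr_w u v : w u v ^+ 2 = v ^+ 2 + delta u ^+ 2.
Proof. by rewrite sqr_sqrtr // addr_ge0 ?sqr_ge0. Qed.

Lemma normal_frame u v : I u -> unit_normal (ruled s e) u v =
  0 *: e u + (delta u / w u v) *: e' u + (- v / w u v) *: z u.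
Proof.
move=> Iu; rewrite /unit_normal partial0_frame // partial1E.
rewrite cross_frame; [|exact: dot_ee|exact: dot_en].
set c := _ - _; have -> : enorm c = w u v.
  rewrite /enorm /wfun; congr Num.sqrt.
  have -> : c = 0 *: e u + delta u *: e' u + (- v) *: z u.
    by rewrite /c scale0r add0r scaleNr.
  by rewrite dot_moving_frame //; ring.
by rewrite /c scale0r add0r scalerBr !scalerA -scaleNr mulNr !(mulrC _^-1).
Qed.

Lemma second_form00 u v : I u -> second_form (ruled s e) u v 0 0 =
  - (k u * v ^+ 2 + derive1 delta u * v + delta u ^+ 2 * (k u - lambda u)) / w u v.
Proof.
move=> Iu; rewrite mxE partial00_frame // normal_frame // dot_moving_frame //.
by field; rewrite gt_eqF // w_gt0.
Qed.

Lemma second_form01 u v : I u -> second_form (ruled s e) u v 0 1 = delta u / w u v.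
Proof.
move=> Iu; rewrite mxE partial10_frame // normal_frame // dot_moving_frame //.
by ring.
Qed.

Lemma second_form10 u v : I u -> second_form (ruled s e) u v 1 0 = delta u / w u v.
Proof.
move=> Iu; rewrite mxE partial01E -(partial10E u v) // partial10_frame //.
by rewrite normal_frame // dot_moving_frame //; ring.
Qed.

Lemma second_form11 u v : second_form (ruled s e) u v 1 1 = 0.
Proof. by rewrite mxE partial11E -(scale0r 0) dotZl mul0r. Qed.

Lemma first_form00 u v : I u ->
  first_form (ruled s e) u v 0 0 = v ^+ 2 + delta u ^+ 2 * (lambda u ^+ 2 + 1).
Proof. by move=> Iu; rewrite mxE partial0_frame // dot_moving_frame //; ring. Qed.

Lemma first_form01 u v : I u ->
  first_form (ruled s e) u v 0 1 = delta u * lambda u.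
Proof.
move=> Iu; rewrite mxE partial0_frame // partial1_frame dot_moving_frame //; ring.
Qed.

Lemma first_form10 u v : I u ->
  first_form (ruled s e) u v 1 0 = delta u * lambda u.
Proof. by move=> Iu; rewrite mxE dotC -(first_form01 u v) // mxE. Qed.

Lemma first_form11 u v : I u -> first_form (ruled s e) u v 1 1 = 1.
Proof. by move=> Iu; rewrite mxE partial1E dot_ee. Qed.

(** This is det (c g - h) = 0 multiplied by w^2, where det g = w^2 and
    v^2 is replaced by w^2 - delta^2. *)
Lemma principal_curvature_eq u v (k1 k2 c : R) : I u ->
  principal_curvatures_at (ruled s e) u v k1 k2 -> c = k1 \/ c = k2 ->
  c ^+ 2 * w u v ^+ 4 + c * w u v *
    (k u * w u v ^+ 2 + derive1 delta u * v + delta u ^+ 2 * lambda u)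
  = delta u ^+ 2.
Proof.
move=> Iu k12 ck; have w0 := w_gt0 u v Iu.
have wn : w u v != 0 by rewrite gt_eqF.
have Ug : first_form (ruled s e) u v \in unitmx.
  rewrite unitmxE det2E first_form00 // first_form01 // first_form10 // first_form11 //.
  rewrite [X in X \is a _](_ : _ = w u v ^+ 2); last by rewrite sqr_w; ring.
  by rewrite unitfE expf_neq0.
have := principal_curvature_det _ _ _ _ _ _ Ug k12 ck.
have entryE (A B : 'M[R]_2) i j : (c *: A - B) i j = c * A i j - B i j.
  by rewrite !mxE.
rewrite det2E !entryE.
rewrite first_form00 // first_form01 // first_form10 // first_form11 //.
rewrite second_form00 // second_form01 // second_form10 // second_form11.
move=> h; apply/eqP; rewrite -subr_eq0; apply/eqP.
move: wn h (sqr_w u v); move: (w u v) => W W0 h W2.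
set d := delta u in h W2 *; set l := lambda u in h *; set K := k u in h *.
set d' := derive1 _ u in h *.
rewrite -[RHS](mulr0 (W ^+ 2)) -h.
have -> : v ^+ 2 = W ^+ 2 - d ^+ 2 by rewrite W2; ring.
by field.
Qed.

(** * The osculating hyperboloid *)

Lemma asymptoticE u v (a : 'rV[R]_2) : I u -> asymptotic (ruled s e) u v a ->
  a 0 0 * (a 0 0 * (k u * v ^+ 2 + derive1 delta u * v
    + delta u ^+ 2 * (k u - lambda u)) - 2 * a 0 1 * delta u) = 0.
Proof.
move=> Iu; rewrite /asymptotic quadratic_form2E second_form00 // second_form01 //.
rewrite second_form10 // second_form11 => h.
have w0 : w u v != 0 by rewrite gt_eqF // w_gt0.
rewrite -[RHS](mulr0 (- w u v)) -h; field; exact: w0.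
Qed.

(** In coordinates (X, Y, Z) for the frame at s(u), the osculating quadric is
    k (Y + delta/k)^2 + (k + lambda) Z^2 - 2 X Z = delta^2 / k, so its centre is
    s - (delta/k) n. For lambda = -1/k, after division by delta^2 / k, the form
    has the double eigenvalue k^2 / delta^2 and the eigenvalue - 1 / delta^2,
    the latter with eigenvector k e + z; hence the squared semi-axes
    p^2 = delta^2 / k^2 and q^2 = delta^2. *)
Lemma osculating_hyperboloid u : I u -> derive1 delta u = 0 ->
  k u * lambda u + 1 = 0 ->
  exists Q, hyperboloid_of_revolution Q /\ osculating_quadric s e u Q.
Proof.
move=> Iu d'0 kl.
have d0 := delta_neq0 u Iu.
have k0 : k u != 0 by apply: contra_eq_neq kl => ->; rewrite mul0r add0r oner_neq0.
pose r := Num.sqrt (1 + k u ^+ 2).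
have r0' : 0 < 1 + k u ^+ 2 by rewrite ltr_pwDl ?sqr_ge0.
have r0 : r != 0 by rewrite gt_eqF // sqrtr_gt0.
have r2 : r ^+ 2 = 1 + k u ^+ 2 by rewrite sqr_sqrtr // ltW.
pose c := s u - (delta u / k u) *: e' u.
pose a := (k u / r) *: e u + 0 *: e' u + r^-1 *: z u.
pose p : R := `|delta u / k u|; pose q := `|delta u|.
exists [set y | (dot (y - c) (y - c) - dot (y - c) a ^+ 2) / p ^+ 2
                   - dot (y - c) a ^+ 2 / q ^+ 2 = 1]; split.
  exists c, a, p, q; split => //.
  - rewrite /enorm dot_moving_frame // [X in Num.sqrt X](_ : _ = 1) ?sqrtr1 //.
    have -> : 1 = (1 + k u ^+ 2) / r ^+ 2 by rewrite -r2 divff // expf_neq0.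
    by field; exact: r0.
  - rewrite normr_gt0; apply: mulf_neq0; [exact: d0 | by rewrite invr_eq0].
  - by rewrite normr_gt0.
move=> v t b /(asymptoticE _ _ _ Iu) asym /=.
have -> : ruled s e u v + t *: tangent_vector (ruled s e) u v b - c =
    (v + t * (b 0 0 * (delta u * lambda u) + b 0 1)) *: e u
    + (t * b 0 0 * v + delta u / k u) *: e' u + (t * b 0 0 * delta u) *: z u.
  rewrite /tangent_vector partial0_frame // partial1E /ruled /c.
  move: (s u) (e u) (e' u) (z u) => y0 y1 y2 y3.
  by apply/rowP => i; rewrite !mxE; ring.
rewrite !dot_moving_frame // {}/a /p /q !real_normK ?num_real //.
have lE : lambda u = - (k u)^-1.
  apply: (mulfI k0); rewrite mulrN mulfV //; apply/eqP; rewrite -addr_eq0; exact/eqP.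
move: asym d0 k0 r0 r2; rewrite d'0 lE.
move: (delta u) (k u) r (b 0 0) (b 0 1) => d K r' b0 b1 asym d0 k0 r0 r2.
have X0 : 1 + K ^+ 2 != 0 by rewrite -r2 expf_neq0.
have axial (x y x' : R) : (x * (K / r') + y * 0 + x' / r') ^+ 2
    = (K * x + x') ^+ 2 / (1 + K ^+ 2).
  by rewrite -r2; field; exact: r0.
rewrite axial; apply/eqP; rewrite -subr_eq0; apply/eqP.
(* The point fails the equation of the quadric by t^2 k / delta^2 times the
   expression that vanishes in asymptotic directions. *)
rewrite -[RHS](mulr0 (t ^+ 2 * K / d ^+ 2)) -[in RHS]asym.
by field; rewrite X0 d0 k0.
Qed.

End SkewRuled.

(** * Curvatures that are powers of w *)

Section PowerCurvature.
Context {R : realType}.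

Lemma poly_eq0_on_ray (p : {poly R}) (c : R) :
  (forall x, c <= x -> p.[x] = 0) -> p = 0.
Proof.
move=> pc; apply/eqP; case: (eqVneq p 0) => // p0.
have := max_poly_roots (rs := [seq c + i%:R | i <- iota 0 (size p)]) p0.
rewrite size_map size_iota ltnn => -> //.
- by apply/allP => _ /mapP[i _ ->]; apply/rootP/pc; rewrite lerDl.
- by rewrite map_inj_uniq ?iota_uniq // => i j /addrI /eqP; rewrite eqr_nat => /eqP.
Qed.

Lemma trinomial_on_ray (a b c x0 : R) :
  (forall x, x0 <= x -> a * x ^+ 2 + b * x + c = 0) ->
  [/\ a = 0, b = 0 & c = 0].
Proof.
move=> abc; have p0 : a *: 'X^2 + b *: 'X + c%:P = 0 :> {poly R}.
  by apply: (poly_eq0_on_ray _ x0) => x /abc <-; rewrite !hornerE.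
have cf i : (a *: 'X^2 + b *: 'X + c%:P : {poly R})`_i = 0 by rewrite p0 coef0.
by have := (cf 0%N, cf 1%N, cf 2%N);
  rewrite !coefE /= !(mulr0, mulr1, addr0, add0r) => -[[]].
Qed.

(** For n = m >= 0 the exponents 2n+4, n+3, n+1, 0 are the ones below. For
    n = - m - 4, multiplication by x^(2m+4) turns 2n+4 and 0 into 0 and 2m+4,
    and n+3, n+1 into m+3, m+1: the same exponents again. *)
Lemma constant_term_on_ray (a b c d x0 : R) (m : nat) :
  (forall x, x0 <= x ->
     a * x ^+ (2 * m + 4) + b * x ^+ (m + 3) + c * x ^+ (m + 1) + d = 0) ->
  d = 0.
Proof.
move=> h; pose p : {poly R} :=
  a *: 'X^(2 * m + 4) + b *: 'X^(m + 3) + c *: 'X^(m + 1) + d%:P.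
have p0 : p = 0.
  by apply: (poly_eq0_on_ray _ x0) => x /h <-; rewrite !hornerE.
have : p`_0 = 0 by rewrite p0 coef0.
by rewrite /p !coefE !addnS /= !mulr0 !add0r.
Qed.

(** The product f g is g^2 where f = g and - g^2 where f = - g. It has no zero,
    so by connectedness it cannot take both signs. *)
Lemma continuous_sqr_eq (I : set R) (f g : R -> R) : is_interval I ->
  {within I, continuous f} -> {within I, continuous g} ->
  (forall u, I u -> g u != 0) -> (forall u, I u -> f u ^+ 2 = g u ^+ 2) ->
  (forall u, I u -> f u = g u) \/ (forall u, I u -> f u = - g u).
Proof.
move=> iI cf cg g0 fg.
have fgE u : I u -> f u = g u \/ f u = - g u.
  by move=> /fg /eqP; rewrite eqf_sqr => /orP[/eqP|/eqP]; tauto.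
apply/or_asboolP; case: asboolP => //= /existsNP[a /not_implyP[Ia fa]].
apply/asboolP => b Ib; case: (fgE b Ib) => // fb; exfalso.
have {}fa : f a = - g a by case: (fgE a Ia).
have cp : {within I, continuous (fun u => f u * g u)}.
  by move=> x; apply: (@continuousM R (subspace I)); [exact: cf|exact: cg].
have ga : 0 < g a * g a by rewrite -expr2 exprn_even_gt0 // g0.
have gb : 0 < g b * g b by rewrite -expr2 exprn_even_gt0 // g0.
have [x Ix x0] : [set f x * g x | x in I] 0.
  have /connected_intervalP itv : connected [set f x * g x | x in I].
    by apply: connected_continuous_connected cp; exact/connected_intervalP.
  apply: (itv (f a * g a) (f b * g b)); [by exists a | by exists b |].
  by rewrite fa fb mulNr oppr_le0 !ltW.
have : f x ^+ 2 * g x ^+ 2 = 0 by rewrite -exprMn x0 expr0n.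
by rewrite fg // => /eqP; rewrite mulf_eq0 orbb expf_eq0 (negPf (g0 x Ix)).
Qed.

(** The equation is that of a principal curvature F w^n along one generator, with
    K, d, l for k, delta, lambda and delta' = 0, at w = x. Negative powers are
    cleared by multiplication, so that coefficients of polynomials in x can be
    compared. *)
Lemma power_curvature_cases (F K d l : R) (n : int) : d != 0 ->
  (forall x : R, `|d| <= x ->
     (F * x ^ n) ^+ 2 * x ^+ 4 + F * x ^ n * x * (K * x ^+ 2 + d ^+ 2 * l) = d ^+ 2) ->
  [\/ [/\ n = - 1, F = - K & K * l + 1 = 0],
      [/\ n = - 2, F ^+ 2 = d ^+ 2, K = 0 & l = 0] |
      [/\ n = - 3, F = d ^+ 2 * K^-1 & K * l + 1 = 0]].
Proof.
move=> d0 eqF; have d2 : d ^+ 2 != 0 by rewrite expf_neq0.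
have F0 : F != 0.
  apply: contra_neq d2 => F0; rewrite -(eqF `|d|) // F0; ring.
have x0 (x : R) : `|d| <= x -> x != 0.
  by move=> dx; rewrite gt_eqF // (lt_le_trans _ dx) // normr_gt0.
have {}eqF (x : R) : `|d| <= x -> (F * x ^ n) ^+ 2 * x ^+ 4
    + F * x ^ n * x * (K * x ^+ 2 + d ^+ 2 * l) - d ^+ 2 = 0.
  by move=> dx; rewrite eqF // subrr.
case: n eqF => [m|[|[|[|m]]]] eqF.
- suff /eqP : - d ^+ 2 = 0 by rewrite oppr_eq0 (negPf d2).
  apply: (constant_term_on_ray (F ^+ 2) (F * K) (F * d ^+ 2 * l) _ `|d| m) => x dx.
  by rewrite -[RHS](eqF x dx) -exprnP (exprD x (2 * m) 4) (mulnC 2%N m)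
    (exprM x) !(exprD x); ring.
- have [x dx|h1 _ h2] :=
    trinomial_on_ray (F ^+ 2 + F * K) 0 (F * d ^+ 2 * l - d ^+ 2) `|d|.
    rewrite -[RHS](eqF x dx) -[x ^ _]/(x^-1); field; exact: x0 dx.
  have FK : F = - K.
    apply: (mulfI F0); rewrite -[LHS]expr2; apply/eqP.
    by rewrite -subr_eq0 mulrN opprK; apply/eqP.
  constructor 1; split => //; apply: (mulfI d2); rewrite mulr0 -[RHS]oppr0 -h2 FK; ring.
- have [x dx|h1 h2 h3] :=
    trinomial_on_ray (F * K) (F ^+ 2 - d ^+ 2) (F * d ^+ 2 * l) `|d|.
    (* n = -2, multiplied by x. *)
    rewrite -[RHS](mulr0 x) -[in RHS](eqF x dx) -[x ^ _]/(x ^- 2); field; exact: x0 dx.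
  constructor 2; split => //.
  + by apply/eqP; rewrite -subr_eq0; apply/eqP.
  + by apply: (mulfI F0); rewrite h1 mulr0.
  + by apply: (mulfI (mulf_neq0 F0 d2)); rewrite h3 mulr0.
- have [x dx|h1 _ h2] :=
    trinomial_on_ray (F * K - d ^+ 2) 0 (F ^+ 2 + F * d ^+ 2 * l) `|d|.
    (* n = -3, multiplied by x^2. *)
    rewrite -[RHS](mulr0 (x ^+ 2)) -[in RHS](eqF x dx) -[x ^ _]/(x ^- 3).
    field; exact: x0 dx.
  have FK : F * K = d ^+ 2 by apply/eqP; rewrite -subr_eq0; apply/eqP.
  have K0 : K != 0 by apply: contra_neq d2 => K0; rewrite -FK K0 mulr0.
  constructor 3; split => //; first by rewrite -FK mulfK.
  by apply: (mulfI (mulf_neq0 F0 F0)); rewrite mulr0 -h2 -FK; ring.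
- suff /eqP : F ^+ 2 = 0 by rewrite expf_eq0 (negPf F0).
  apply: (constant_term_on_ray (- d ^+ 2) (F * K) (F * d ^+ 2 * l) _ `|d| m) => x dx.
  rewrite -[RHS](mulr0 (x ^+ (2 * m + 4))) -[in RHS](eqF x dx).
  rewrite -[x ^ _]/((x ^+ m.+4)^-1) -(addn4 m) (exprD x (2 * m) 4)
    (mulnC 2%N m) (exprM x) !(exprD x).
  by field; rewrite expf_neq0 // (x0 x dx).
Qed.

(** The exponent n is common to all generators, hence so is the case. *)
Lemma power_curvature_cases_on (I : set R) (F K d l : R -> R) (n : int) :
  I !=set0 -> (forall u, I u -> d u != 0) ->
  (forall u x, I u -> `|d u| <= x ->
     (F u * x ^ n) ^+ 2 * x ^+ 4
     + F u * x ^ n * x * (K u * x ^+ 2 + d u ^+ 2 * l u) = d u ^+ 2) ->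
  [\/ n = - 1 /\ forall u, I u -> F u = - K u /\ K u * l u + 1 = 0,
      n = - 2 /\ forall u, I u -> [/\ F u ^+ 2 = d u ^+ 2, K u = 0 & l u = 0] |
      n = - 3 /\ forall u, I u -> F u = d u ^+ 2 * (K u)^-1 /\ K u * l u + 1 = 0].
Proof.
move=> [u0 Iu0] d0 eqF.
have cases u (Iu : I u) := power_curvature_cases (F u) (K u) (d u) (l u) n (d0 u Iu)
  (fun x => eqF u x Iu).
by case: (cases u0 Iu0) => -[n1 *]; [constructor 1|constructor 2|constructor 3];
  split=> // u /cases[] []; rewrite n1.
Qed.

End PowerCurvature.

Theorem proposition1 (R : realType) (I : set R) (s e : R -> 'rV[R]_3)
    (k1 k2 : R -> R -> R) (f : R -> R) (n : int)
    (I_open : open I) (I_interval : is_interval I) (I_nonempty : I !=set0)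
    (Phi_skew : skew_ruled_surface s e I)
    (k12 : forall u v : R, I u ->
       principal_curvatures_at (ruled s e) u v (k1 u v) (k2 u v))
    (f_continuous : {within I, continuous f})
    (k_form : (forall u v : R, I u -> k1 u v = f u * wfun s e u v ^ n) \/
              (forall u v : R, I u -> k2 u v = f u * wfun s e u v ^ n)) :
  [\/ [/\ n = - 1,
          forall u, I u -> f u = - conical_curvature e u &
          edlinger s e I],
      [/\ n = - 2,
          (forall u, I u -> f u = drall s e u) \/
          (forall u, I u -> f u = - drall s e u) &
          right_helicoid s e I] |
      [/\ n = - 3,
          forall u, I u ->
            f u = drall s e u ^+ 2 * (conical_curvature e u)^-1 &
          edlinger s e I]].
Proof.
pose w := wfun s e; pose d := drall s e.
have d0 u : I u -> d u != 0 by exact: delta_neq0.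
have eqf u v : I u -> (f u * w u v ^ n) ^+ 2 * w u v ^+ 4 + f u * w u v ^ n * w u v *
    (conical_curvature e u * w u v ^+ 2 + derive1 d u * v
     + d u ^+ 2 * cot_striction s e u) = d u ^+ 2.
  move=> Iu; apply: (principal_curvature_eq I s e I_open Phi_skew u v _ _ _ Iu
    (k12 u v Iu)).
  by case: k_form => kf; [left|right]; rewrite kf.
(* Only the term delta' v is odd in v. *)
have d'0 u : I u -> derive1 d u = 0.
  move=> Iu; have wN : w u (-1) = w u 1 by rewrite /w /wfun sqrrN.
  have f0 : f u != 0.
    apply: contra_neq (expf_neq0 2 (d0 u Iu)) => f0.
    by rewrite -(eqf u 0 Iu) f0; ring.
  have W0 : w u 1 != 0 by rewrite gt_eqF // (w_gt0 I).
  have c0 : f u * w u 1 ^ n * w u 1 != 0 by rewrite !mulf_neq0 // expfz_neq0.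
  apply: (mulfI c0); rewrite mulr0.
  by have := eqf u 1 Iu; have := eqf u (-1) Iu; rewrite wN; lra.
have ray u x : I u -> `|d u| <= x ->
    (f u * x ^ n) ^+ 2 * x ^+ 4 + f u * x ^ n * x *
      (conical_curvature e u * x ^+ 2 + d u ^+ 2 * cot_striction s e u) = d u ^+ 2.
  move=> Iu dx; have x0 : 0 <= x := le_trans (normr_ge0 _) dx.
  (* The value x of w is attained at v = sqrt (x^2 - delta^2). *)
  have wx : w u (Num.sqrt (x ^+ 2 - d u ^+ 2)) = x.
    rewrite /w /wfun sqr_sqrtr ?subrK ?sqrtr_sqr ?ger0_norm //.
    by rewrite subr_ge0 -(real_normK (num_real (d u))) ler_sqr ?nnegrE.
  by have := eqf u (Num.sqrt (x ^+ 2 - d u ^+ 2)) Iu; rewrite wx d'0 // mul0r addr0.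
have edl : (forall u, I u -> conical_curvature e u * cot_striction s e u + 1 = 0) ->
    edlinger s e I.
  move=> kl u Iu; split; [|exact: d'0|exact: kl].
  exact: (osculating_hyperboloid I s e I_open Phi_skew u Iu (d'0 u Iu) (kl u Iu)).
case: (power_curvature_cases_on I f (conical_curvature e) d (cot_striction s e) n
  I_nonempty d0 ray) => -[n1 all_u].
- constructor 1; split; [exact: n1 | by move=> u /all_u[] |].
  by apply: edl => u /all_u[].
- constructor 2; split; first exact: n1.
    apply: (continuous_sqr_eq I f d I_interval f_continuous _ d0).
      apply: continuous_in_subspaceT => u /set_mem Iu.
      apply/differentiable_continuous/derivable1_diffP.
      exact: (delta_derivable I s e I_open Phi_skew u Iu).
    by move=> u /all_u[].
  by move=> u Iu; have [_ K0 l0] := all_u u Iu; split; [| |exact: d'0].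
- constructor 3; split; [exact: n1 | by move=> u /all_u[] |].
  by apply: edl => u /all_u[].
Qed.
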